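(* Let $\mathsf{A}:\mathbb{R}^{d\times N}\to\mathbb{R}^{d\times N}$ be causal multi-head self-attention with rotary positional encoding (RoPE) as defined in the context, and let $\mathbf{X}\in\mathbb{R}^{d\times N}$. 1. Let $1\le p,q\le\infty$. The absolute normwise condition number of $\mathsf{A}$ satisfies $$\tilde\kappa_{(1,p),(1,q)}(\mathsf{A},\mathbf{X})\le\|\mathbf{W}_O\|_{(1,q),q}\max_{1\le h\le n_{head}}\tilde\kappa_{h,p,q}(\mathsf{A}),\qquad\tilde\kappa_{h,p,q}(\mathsf{A})=\max_{1\le n\le N}\|\mathbf{J}_{h,n}(\mathbf{X})\|_{(1,p),q}.$$ Denote $\tilde\kappa_h(\mathsf{S})=\max_{1\le n\le N}\|\mathbf{J}_{\mathsf{S}}(\mathbf{b}_{h,n})\|_{\infty,1}$. Then $$\tilde\kappa_{h,p,q}(\mathsf{A})\le\|\mathbf{W}_{V,h}\|_{p,q}\Big(1+\tilde\kappa_h(\mathsf{S})M_p\|\mathbf{X}\|_{1,p}^2\Big),\qquad M_p=2d_{head}^{-1/2}\|\mathbf{W}_{Q,h}\|_{p,2}\|\mathbf{W}_{K,h}\|_{p,2}.$$ 2. Denote by $\mathbf{f}_i\in\mathbb{R}^N$ the $i$th row of $\mathbf{X}$. If $\|\mathbf{f}_i\|_\infty\le\vartheta<\|\mathbf{f}_1\|_\infty$ for all $i\ge2$, then $$\tilde\kappa_{h,\infty,\infty}(\mathsf{A})\le\|\mathbf{W}_{V,h}\|_{\infty,\infty}+\tilde\kappa_h(\mathsf{S})\Big(\|\mathbf{w}_{V,h,1}\|_\infty\|\mathbf{X}\|_{1,\infty}+\|\mathbf{W}_{V,h}\|_{\infty,\infty}\vartheta\Big)\Big(\mu_\infty\|\mathbf{X}\|_{1,\infty}+M_\infty\vartheta\Big),$$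 $$\mu_\infty=d_{head}^{-1/2}\big(\|\mathbf{W}_{K,h}\|_{\infty,2}\|\mathbf{w}_{Q,h,1}\|_2+\|\mathbf{W}_{Q,h}\|_{\infty,2}\|\mathbf{w}_{K,h,1}\|_2\big),$$ where $\mathbf{w}_{V,h,1},\mathbf{w}_{Q,h,1},\mathbf{w}_{K,h,1}$ are the first columns of $\mathbf{W}_{V,h},\mathbf{W}_{Q,h},\mathbf{W}_{K,h}$. 3. In the absence of RoPE (all $\mathbf{R}_t=\mathbf{I}$), the constants in parts 1 and 2 can be improved to $$M_p=2d_{head}^{-1/2}\|\mathbf{W}_{Q,h}^\top\mathbf{W}_{K,h}\|_{p,p^*},\quad\tfrac1p+\tfrac1{p^*}=1,\qquad\mu_\infty=d_{head}^{-1/2}\big(\|\mathbf{W}_{K,h}^\top\mathbf{w}_{Q,h,1}\|_1+\|\mathbf{W}_{Q,h}^\top\mathbf{w}_{K,h,1}\|_1\big).$$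
   Context: Self-attention. Let $d=n_{head}d_{head}$ and $\mathbf{W}_Q,\mathbf{W}_K,\mathbf{W}_V,\mathbf{W}_O\in\mathbb{R}^{d\times d}$. Split the rows of $\mathbf{W}_Q,\mathbf{W}_K,\mathbf{W}_V$ into $n_{head}$ consecutive blocks $\mathbf{W}_{Q,h},\mathbf{W}_{K,h},\mathbf{W}_{V,h}\in\mathbb{R}^{d_{head}\times d}$. The RoPE matrices $\{\mathbf{R}_t\}_{t\in\mathbb{Z}}\subset\mathbb{R}^{d_{head}\times d_{head}}$ are fixed orthogonal (rotation) matrices forming a multiplicative group. For $\mathbf{X}=[\mathbf{x}_1\cdots\mathbf{x}_N]$ let $\mathbf{q}_{h,n}=\mathbf{W}_{Q,h}\mathbf{x}_n$, $\mathbf{k}_{h,n}=\mathbf{W}_{K,h}\mathbf{x}_n$, $\mathbf{v}_{h,n}=\mathbf{W}_{V,h}\mathbf{x}_n$; let $\mathbf{b}_{h,n}\in\mathbb{R}^n$ have $t$th entry $d_{head}^{-1/2}(\mathbf{R}_t\mathbf{k}_{h,t})^\top\mathbf{R}_n\mathbf{q}_{h,n}$, $1\le t\le n$; let $\mathbf{a}_{h,n}=[\mathbf{v}_{h,1}\cdots\mathbf{v}_{h,n}]\,\mathsf{S}(\mathbf{b}_{h,n})\in\mathbb{R}^{d_{head}}$, where $\mathsf{S}(\mathbf{b})_i=\exp(b_i)/\sum_j\exp(b_j)$ is softmax. The $n$th column of $\mathsf{A}(\mathbf{X})$ is $\mathbf{W}_O[\mathbf{a}_{1,n}^\top\cdots\mathbf{a}_{n_{head},n}^\top]^\top$.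 $\mathbf{J}_{h,n}(\mathbf{X})\in\mathbb{R}^{d_{head}\times dn}$ is the Jacobian of $\mathbf{a}_{h,n}$ with respect to $[\mathbf{x}_1^\top\cdots\mathbf{x}_n^\top]^\top$; $\mathbf{J}_{\mathsf{S}}$ is the Jacobian of softmax; $\mathbf{J}_{\mathsf{A}}(\mathbf{X})\in\mathbb{R}^{dN\times dN}$ is the Jacobian of $\mathsf{A}$ with input and output vectorised by stacking columns. Norms. $\|\cdot\|_{p,q}$ is the $\ell_p\to\ell_q$ operator norm; in particular $\|\mathbf{X}\|_{1,p}=\max_n\|\mathbf{x}_n\|_p$. For a vector partitioned into consecutive blocks, $\|\cdot\|_{(1,p)}$ is the maximum of the $\ell_p$ norms of the blocks; the blocks have length $d$ for vectorised inputs/outputs of $\mathsf{A}$ and for inputs of $\mathbf{J}_{h,n}$, and length $d_{head}$ for inputs of $\mathbf{W}_O$. $\|\cdot\|_{(1,p),(1,q)}$ and $\|\cdot\|_{(1,p),q}$ are the operator norms from $\|\cdot\|_{(1,p)}$ to $\|\cdot\|_{(1,q)}$ and to $\|\cdot\|_q$. The absolute condition number is $\tilde\kappa_{(1,p),(1,q)}(\mathsf{A},\mathbf{X})=\|\mathbf{J}_{\mathsf{A}}(\mathbf{X})\|_{(1,p),(1,q)}$. *)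

(* Defs.v *)
From HB Require Import structures.
From mathcomp Require Import all_boot all_order all_algebra.
From mathcomp Require Import all_classical all_reals all_analysis.
Set Implicit Arguments.
Unset Strict Implicit.
Unset Printing Implicit Defensive.
Import Order.TTheory GRing.Theory Num.Theory.
Import numFieldNormedType.Exports.
Local Open Scope ring_scope.

Lemma index_pairs (T U : eqType) (s : seq T) (t : seq U) x y :
  x \in s -> y \in t ->
  index (x, y) [seq (a, b) | a <- s, b <- t] =
  (index x s * size t + index y t)%N.
Proof.
move=> + yt; elim: s => // a s IHs; rewrite inE index_cat /= eq_sym.
have [-> _|nxa /= xs] := eqVneq x a.
  by rewrite map_f // index_map // => ? ? [].
case: ifP => [/mapP[b _ [xa _]]|_]; first by rewrite xa eqxx in nxa.
by rewrite size_map IHs // mulSn addnA.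
Qed.

(* [mxvec_index h i] is the position of entry [i] of block [h] when
   [m * k] indices are cut into [m] consecutive blocks of length [k]. *)
Lemma val_mxvec_index m k (h : 'I_m) (i : 'I_k) :
  mxvec_index h i = (h * k + i)%N :> nat.
Proof.
rewrite /mxvec_index /= /enum_rank [@enum_rank_in]unlock insubdK; last first.
  by rewrite unfold_in cardE index_mem mem_enum.
rewrite enumT unlock /= /prod_enum index_pairs ?mem_enum //.
by rewrite !index_enum_ord size_enum_ord.
Qed.

(* The library's [mxvec] stacks rows; [vec] stacks columns. *)
Definition vec {R : realType} {m n : nat} (A : 'M[R]_(m, n)) : 'cV[R]_(n * m) :=
  (mxvec A^T)^T.

Definition unvec {R : realType} {m n : nat} (v : 'cV[R]_(n * m)) : 'M[R]_(m, n) :=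
  (vec_mx v^T)^T.

(* The library's Jacobian is for row vectors and acts on the right. *)
Definition jac {R : realType} {m n : nat} (f : 'cV[R]_m -> 'cV[R]_n)
    (x : 'cV[R]_m) : 'M[R]_(n, m) :=
  (jacobian (fun v : 'rV[R]_m => (f v^T)^T) x^T)^T.

Section Norms.
Context {R : realType}.

(* Only used for 1 <= p. *)
Definition lpnorm {n : nat} (p : \bar R) (x : 'cV[R]_n) : R :=
  match p with
  | EFin r => (\sum_(i < n) `|x i 0| `^ r) `^ r^-1
  | +oo%E => \big[Num.max/0]_(i < n) `|x i 0|
  | -oo%E => 0
  end.

Definition blocknorm (m k : nat) (p : \bar R) (v : 'cV[R]_(m * k)) : R :=
  \big[Num.max/0]_(b < m) lpnorm p (\col_(i < k) v (mxvec_index b i) 0).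

Definition opnorm {m n : nat} (nu : 'cV[R]_n -> R) (mu : 'cV[R]_m -> R)
    (A : 'M[R]_(m, n)) : R :=
  sup [set mu (A *m x) | x in [set x | nu x <= 1]]%classic.

Definition lpopnorm {m n : nat} (p q : \bar R) (A : 'M[R]_(m, n)) : R :=
  opnorm (lpnorm p) (lpnorm q) A.

Definition softmax {n : nat} (b : 'cV[R]_n) : 'cV[R]_n :=
  \col_(i < n) (expR (b i 0) / \sum_(j < n) expR (b j 0)).

(* Orthogonal matrices whose set of values is a group; in particular this
   covers families with [rope (s + t) = rope s *m rope t]. *)
Definition rope_group {k : nat} (rope : int -> 'M[R]_k) : Prop :=
  [/\ forall t, (rope t)^T *m rope t = 1%:M,
      exists t, rope t = 1%:M,
      forall s t, exists u, rope u = rope s *m rope t &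
      forall t, exists u, rope u *m rope t = 1%:M].

End Norms.

Section Attention.
Context {R : realType} {nhead dhead : nat}.
Local Notation d := (nhead * dhead)%N.

Definition head_rows (W : 'M[R]_d) (h : 'I_nhead) : 'M[R]_(dhead, d) :=
  rowsub (mxvec_index h) W.

Section Head.
Variables (WQ WK WV : 'M[R]_d) (rope : int -> 'M[R]_dhead) (h : 'I_nhead).

(* For a sequence of length n+1: the scores of its last token. Columns are
   indexed from 0 and RoPE positions from 1. *)
Definition scores {n : nat} (X : 'M[R]_(d, n.+1)) : 'cV[R]_n.+1 :=
  \col_(t < n.+1)
    ((Num.sqrt dhead%:R)^-1 *
     ((rope (Posz t.+1) *m (head_rows WK h *m col t X))^T
        *m (rope (Posz n.+1) *m (head_rows WQ h *m col ord_max X))) 0 0).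

Definition head_last {n : nat} (X : 'M[R]_(d, n.+1)) : 'cV[R]_dhead :=
  (head_rows WV h *m X) *m softmax (scores X).

End Head.

(* Column [n : 'I_N] is token n+1, which attends to the first n+1 tokens. *)
Definition prefix {N : nat} (n : 'I_N) (X : 'M[R]_(d, N)) : 'M[R]_(d, n.+1) :=
  colsub (widen_ord (ltn_ord n)) X.

Definition attention (WQ WK WV WO : 'M[R]_d) (rope : int -> 'M[R]_dhead)
    {N : nat} (X : 'M[R]_(d, N)) : 'M[R]_(d, N) :=
  \matrix_(i < d, n < N)
    (WO *m vec (\matrix_(j < dhead, h < nhead)
                  head_last WQ WK WV rope h (prefix n X) j 0)) i 0.

Definition cond_attention (p q : \bar R) (WQ WK WV WO : 'M[R]_d)
    (rope : int -> 'M[R]_dhead) {N : nat} (X : 'M[R]_(d, N)) : R :=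
  opnorm (@blocknorm R N d p) (@blocknorm R N d q)
    (jac (fun v : 'cV[R]_(N * d) => vec (attention WQ WK WV WO rope (unvec v)))
         (vec X)).

Definition jac_head (WQ WK WV : 'M[R]_d) (rope : int -> 'M[R]_dhead)
    (h : 'I_nhead) {N : nat} (n : 'I_N) (X : 'M[R]_(d, N)) :
    'M[R]_(dhead, n.+1 * d) :=
  jac (fun v : 'cV[R]_(n.+1 * d) => head_last WQ WK WV rope h (unvec v))
      (vec (prefix n X)).

Definition cond_head (p q : \bar R) (WQ WK WV : 'M[R]_d)
    (rope : int -> 'M[R]_dhead) (h : 'I_nhead) {N : nat} (X : 'M[R]_(d, N)) : R :=
  \big[Num.max/0]_(n < N)
    opnorm (@blocknorm R n.+1 d p) (lpnorm q) (jac_head WQ WK WV rope h n X).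

Definition cond_softmax (WQ WK : 'M[R]_d) (rope : int -> 'M[R]_dhead)
    (h : 'I_nhead) {N : nat} (X : 'M[R]_(d, N)) : R :=
  \big[Num.max/0]_(n < N)
    lpopnorm +oo%E 1%E (jac softmax (scores WQ WK rope h (prefix n X))).

Definition M_rope (p : \bar R) (WQ WK : 'M[R]_d) (h : 'I_nhead) : R :=
  2 * (Num.sqrt dhead%:R)^-1
    * lpopnorm p 2%:E (head_rows WQ h) * lpopnorm p 2%:E (head_rows WK h).

(* [i1] is the index of the first column. *)
Definition mu_rope (WQ WK : 'M[R]_d) (h : 'I_nhead) (i1 : 'I_d) : R :=
  (Num.sqrt dhead%:R)^-1 *
    (lpopnorm +oo%E 2%:E (head_rows WK h) * lpnorm 2%:E (col i1 (head_rows WQ h))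
     + lpopnorm +oo%E 2%:E (head_rows WQ h) * lpnorm 2%:E (col i1 (head_rows WK h))).

Definition M_norope (p : \bar R) (WQ WK : 'M[R]_d) (h : 'I_nhead) : R :=
  2 * (Num.sqrt dhead%:R)^-1
    * lpopnorm p (hoelder_conjugate p) ((head_rows WQ h)^T *m head_rows WK h).

Definition mu_norope (WQ WK : 'M[R]_d) (h : 'I_nhead) (i1 : 'I_d) : R :=
  (Num.sqrt dhead%:R)^-1 *
    (lpnorm 1%E ((head_rows WK h)^T *m col i1 (head_rows WQ h))
     + lpnorm 1%E ((head_rows WQ h)^T *m col i1 (head_rows WK h))).

End Attention.

(* Main.v *)
(* Differentiating a = V X S(b) gives Da[Z] = V Z S(b) + V X J_S(b) Db[Z].
   Since S(b) has l1 norm 1, the first term has lq norm at most ||V||_{p,q} for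
   every Z with ||Z||_{1,p} <= 1, and the second one at most
     (max_j ||V x_j||_q) * ||J_S(b)||_{oo,1} * ||Db[Z]||_oo.
   Each entry of Db[Z] is a sum of two bilinear forms in K z_t, Q x_n and
   K x_t, Q z_n; these are bounded by Cauchy-Schwarz and the orthogonality of
   the rotations, or, without RoPE, by Hoelder's inequality applied to
   z^T (Q^T K) x.  For part 2 every column is split as x = x_1 e_1 + r with
   ||r||_oo <= theta before these bounds are applied.
   Vectors attaining Hoelder's inequality give both the triangle inequality
   of the lp norms and the comparison of the constants with and without RoPE. *)
Require Import Defs.
From HB Require Import structures.
From mathcomp Require Import all_boot all_order all_algebra.
From mathcomp Require Import all_classical all_reals all_analysis.
From mathcomp Require Import ring.
Set Implicit Arguments.
Unset Strict Implicit.
Unset Printing Implicit Defensive.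
Import Order.TTheory GRing.Theory Num.Theory.
Import numFieldNormedType.Exports.
Local Open Scope ring_scope.

(** * Differentials of matrix-valued maps *)

Section MatrixCalculus.
Context {R : realType} {U : normedModType R}.

(** [F] is a finite sum of scalar entries times fixed basis matrices, so differentiability may be
    checked entry by entry. *)
Lemma differentiable_mx m n (F : U -> 'M[R]_(m, n)) x :
  (forall i j, differentiable (fun u => F u i j) x) -> differentiable F x.
Proof.
move=> dF.
have -> : F = \sum_(i < m) \sum_(j < n) (fun u => F u i j *: delta_mx i j).
  apply/funext => u; rewrite [LHS]matrix_sum_delta fct_sumE.
  by apply: eq_bigr => i _; rewrite fct_sumE.
apply: differentiable_sum => i; apply: differentiable_sum => j.
exact: differentiableZl.
Qed.

Lemma differentiable_entry m n (F : U -> 'M[R]_(m, n)) x i j :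
  differentiable F x -> differentiable (fun u => F u i j) x.
Proof.
move=> dF.
exact: (differentiable_comp dF (differentiable_coord (F x) i j)).
Qed.

Lemma diff_entry m n (F : U -> 'M[R]_(m, n)) x v i j :
  differentiable F x -> ('d F x v) i j = 'd (fun u => F u i j) x v.
Proof.
move=> dF; rewrite -!deriveE //; last exact: differentiable_entry.
by rewrite derive_mx ?mxE //; exact: diff_derivable.
Qed.

Lemma differentiable_mulmx m k n (F : U -> 'M[R]_(m, k))
    (G : U -> 'M[R]_(k, n)) x :
  differentiable F x -> differentiable G x ->
  differentiable (fun u => F u *m G u) x.
Proof.
move=> dF dG; apply: differentiable_mx => i j.
have -> : (fun u => (F u *m G u) i j) =
    \sum_(l < k) ((fun u => F u i l) * (fun u => G u l j)).
  by apply/funext => u; rewrite mxE fct_sumE.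
by apply: differentiable_sum => l; apply: differentiableM;
  exact: differentiable_entry.
Qed.

(** Each entry of the product is a sum of products of scalar functions, to which the scalar Leibniz
    rule applies; commutativity of the scalars then restores the order of the matrix factors. *)
Lemma diff_mulmx m k n (F : U -> 'M[R]_(m, k))
    (G : U -> 'M[R]_(k, n)) x v :
  differentiable F x -> differentiable G x ->
  'd (fun u => F u *m G u) x v = 'd F x v *m G x + F x *m 'd G x v.
Proof.
move=> dF dG; have dFG := differentiable_mulmx dF dG.
apply/matrixP => i j; rewrite diff_entry //.
rewrite -deriveE; last exact: differentiable_entry.
have -> : (fun u => (F u *m G u) i j) =
    \sum_(l < k) ((fun u => F u i l) * (fun u => G u l j)).
  by apply/funext => u; rewrite mxE fct_sumE.
have dFl l := differentiable_entry i l dF.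
have dGl l := differentiable_entry l j dG.
rewrite derive_sum => [|l]; last first.
  by apply: diff_derivable; exact: differentiableM.
rewrite !mxE -big_split /=; apply: eq_bigr => l _.
rewrite deriveM; [|exact: diff_derivable..].
rewrite (deriveE _ (dFl l)) (deriveE _ (dGl l)) -(diff_entry _ _ _ dF).
by rewrite -(diff_entry _ _ _ dG) addrC; congr (_ + _); rewrite mulrC.
Qed.

End MatrixCalculus.

Section MatrixLinear.
Context {R : realType}.

(** In finite dimension a linear map is a sum of coordinates times the fixed images of the basis
    matrices; such a sum is differentiable, hence continuous. *)
Lemma linear_mx_continuous m n (V : normedModType R)
  (f : {linear 'M[R]_(m, n) -> V}) : continuous f.
Proof.
move=> x; apply: (@differentiable_continuous R).
have -> : f = (\sum_(i < m) \sum_(j < n)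
    fun u : 'M[R]_(m, n) => u i j *: f (delta_mx i j)) :> ('M[R]_(m, n) -> V).
  apply/funext => u; rewrite {1}[u]matrix_sum_delta linear_sum fct_sumE.
  apply: eq_bigr => i _; rewrite linear_sum fct_sumE; apply: eq_bigr => j _.
  by rewrite linearZ.
apply: differentiable_sum => i; apply: differentiable_sum => j.
exact/differentiableZl/differentiable_coord.
Qed.

Lemma differentiable_linear_mx m n (V : normedModType R)
  (f : 'M[R]_(m, n) -> V) x : linear f -> differentiable f x.
Proof.
move=> lf; pose fl : {linear _ -> _} :=
  HB.pack f (GRing.isLinear.Build _ _ _ _ _ lf).
exact: (linear_differentiable x (@linear_mx_continuous _ _ _ fl)).
Qed.

Lemma diff_linear_mx m n (V : normedModType R)
  (f : 'M[R]_(m, n) -> V) x v : linear f -> 'd f x v = f v.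
Proof.
move=> lf; pose fl : {linear _ -> _} :=
  HB.pack f (GRing.isLinear.Build _ _ _ _ _ lf).
by rewrite (diff_lin x (@linear_mx_continuous _ _ _ fl)).
Qed.

Lemma diff_compE (U V W : normedModType R) (f : U -> V) (g : V -> W) x v :
  differentiable f x -> differentiable g (f x) ->
  'd (fun u => g (f u)) x v = 'd g (f x) ('d f x v).
Proof. by move=> df dg; rewrite (diff_comp df dg). Qed.

(** The chain rule applied to [f] between two transpositions, each its own differential. This allows
    all later computations to use differentials instead of Jacobian matrices. *)
Lemma jacE m n (f : 'cV[R]_m -> 'cV[R]_n) x z :
  differentiable f x -> jac f x *m z = 'd f x z.
Proof.
move=> df.
have trl p q : linear (@trmx R p q) by move=> a u v; rewrite linearP.
have dtr := differentiable_linear_mx x^T (trl _ _).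
have df1 : differentiable f (trmx x^T) by rewrite trmxK.
have dtr2 := differentiable_linear_mx (f (trmx x^T)) (trl _ _).
have dfT := differentiable_comp dtr df1.
rewrite /jac -[z in LHS]trmxK -trmx_mul /jacobian mul_rV_lin1 /=.
rewrite (diff_compE z^T dfT dtr2) (diff_compE z^T dtr df1).
rewrite (diff_linear_mx x^T z^T (trl _ _)).
rewrite (diff_linear_mx _ _ (trl _ _)).
by rewrite !trmxK.
Qed.

End MatrixLinear.

(** * Differentiability of softmax *)

Lemma sum_expR_gt0 (R : realType) n (b : 'cV[R]_n.+1) :
  0 < \sum_j expR (b j 0).
Proof.
(* The dimension is a successor, so there is a first term to make the sum strictly positive. *)
rewrite big_ord_recl ltr_pwDl ?expR_gt0 //.
by apply: sumr_ge0 => k _; exact: expR_ge0.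
Qed.

Lemma differentiable_softmax (R : realType) n (b : 'cV[R]_n.+1) :
  differentiable softmax b.
Proof.
apply: differentiable_mx => i j.
have dexp k : differentiable (fun b : 'cV[R]_n.+1 => expR (b k 0) : R) b.
  apply: (differentiable_comp (differentiable_coord b k 0)).
  exact/derivable1_diffP/derivable_expR.
have -> : (fun u : 'cV[R]_n.+1 => softmax u i j) =
    ((fun u : 'cV[R]_n.+1 => expR (u i 0) : R) *
     (fun u : 'cV[R]_n.+1 => ((\sum_(j < n.+1)
         (fun u : 'cV[R]_n.+1 => expR (u j 0) : R)) u)^-1 : R)).
  by apply/funext => u; rewrite mxE fct_sumE.
apply: differentiableM => //; apply: differentiableV.
  exact: differentiable_sum.
by rewrite fct_sumE gt_eqF // sum_expR_gt0.
Qed.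

(** * Stacking of columns as a linear bijection *)

Section Vectorisation.
Context {R : realType} {m n : nat}.

Lemma vecE (A : 'M[R]_(m, n)) i j : vec A (mxvec_index j i) 0 = A i j.
Proof. by rewrite !mxE mxvecE mxE. Qed.

Lemma vecK : cancel (@vec R m n) unvec.
Proof. by move=> A; rewrite /unvec /vec trmxK mxvecK trmxK. Qed.

Lemma unvecK : cancel (@unvec R m n) vec.
Proof. by move=> v; rewrite /unvec /vec trmxK vec_mxK trmxK. Qed.

Lemma linear_vec : linear (@vec R m n).
Proof. by move=> a A B; rewrite /vec !linearP. Qed.

Lemma linear_unvec : linear (@unvec R m n).
Proof. by move=> a A B; rewrite /unvec !linearP. Qed.

End Vectorisation.

(** * Derivatives of the attention map *)

Section AttentionCalculus.
Context {R : realType} {nhead dhead : nat}.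
Local Notation d := (nhead * dhead)%N.
Variables (WQ WK WV WO : 'M[R]_d) (rope : int -> 'M[R]_dhead).

Lemma linear_prefix N (n : 'I_N) :
  linear (fun X : 'M[R]_(d, N) => Defs.prefix n X).
Proof. by move=> a A B; apply/matrixP => i j; rewrite !mxE. Qed.

Section Head.
Variable h : 'I_nhead.

Definition query {n} (X : 'M[R]_(d, n.+1)) : 'cV[R]_dhead :=
  rope (Posz n.+1) *m (head_rows WQ h *m col ord_max X).

Definition key {n} (t : 'I_n) (X : 'M[R]_(d, n)) : 'cV[R]_dhead :=
  rope (Posz t.+1) *m (head_rows WK h *m col t X).

Lemma linear_query n : linear (@query n).
Proof. by move=> a A B; rewrite /query !linearP. Qed.

(** The transposed key is the left factor of the product that defines a score. *)
Lemma linear_keyT n (t : 'I_n) : linear (fun X : 'M[R]_(d, n) => (key t X)^T).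
Proof. by move=> a A B; rewrite /key !linearP. Qed.

(** Exhibits a score as an entry of a scaled matrix product, the form to which the matrix product
    rule applies. *)
Lemma scores_entryE n (t : 'I_n.+1) j :
  (fun X : 'M[R]_(d, n.+1) => scores WQ WK rope h X t j) =
  (fun X => ((Num.sqrt dhead%:R)^-1 *: ((key t X)^T *m query X)) 0 0).
Proof. by apply/funext => X; rewrite /scores !mxE. Qed.

Let dkq n (t : 'I_n.+1) (X : 'M[R]_(d, n.+1)) :
  differentiable (fun X : 'M[R]_(d, n.+1) => (key t X)^T *m query X) X.
Proof.
apply: differentiable_mulmx; apply: differentiable_linear_mx.
- exact: linear_keyT.
- exact: linear_query.
Qed.

Lemma differentiable_scores n (X : 'M[R]_(d, n.+1)) :
  differentiable (scores WQ WK rope h) X.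
Proof.
apply: differentiable_mx => t j; rewrite scores_entryE.
by apply: differentiable_entry; apply: differentiableZ.
Qed.

Lemma diff_scores n (X Z : 'M[R]_(d, n.+1)) t :
  ('d (scores WQ WK rope h) X Z) t 0 = (Num.sqrt dhead%:R)^-1 *
    (((key t Z)^T *m query X) 0 0 + ((key t X)^T *m query Z) 0 0).
Proof.
rewrite (diff_entry _ _ _ (differentiable_scores X)) scores_entryE.
rewrite -(diff_entry _ _ _ (differentiableZ _ (dkq t X))).
rewrite (diffZ _ (dkq t X)) mxE; congr (_ * _).
rewrite diff_mulmx; [|apply: differentiable_linear_mx..]; last 2 first.
- exact: linear_keyT.
- exact: linear_query.
rewrite mxE (diff_linear_mx _ _ (linear_keyT _)).
by rewrite (diff_linear_mx _ _ (@linear_query n)).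
Qed.

Let lV n : linear (fun X : 'M[R]_(d, n) => head_rows WV h *m X).
Proof. by move=> a A B; rewrite !linearP. Qed.

Let dsoft n (X : 'M[R]_(d, n.+1)) :
  differentiable (fun X : 'M[R]_(d, n.+1) => softmax (scores WQ WK rope h X)) X.
Proof.
exact: differentiable_comp (differentiable_scores X) (differentiable_softmax _).
Qed.

Lemma differentiable_head_last n (X : 'M[R]_(d, n.+1)) :
  differentiable (head_last WQ WK WV rope h) X.
Proof.
exact: differentiable_mulmx (differentiable_linear_mx X (@lV n.+1)) (dsoft X).
Qed.

(** Product rule for the values times the softmax weights, then chain rule for softmax of the
    scores. The value matrix stands outermost, so that its operator norm can be split off the first
    term. *)
Lemma diff_head_last n (X Z : 'M[R]_(d, n.+1)) :
  'd (head_last WQ WK WV rope h) X Z =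
    head_rows WV h *m (Z *m softmax (scores WQ WK rope h X)) +
    head_rows WV h *m (X *m (jac softmax (scores WQ WK rope h X) *m
                             'd (scores WQ WK rope h) X Z)).
Proof.
apply: etrans.
  exact: (diff_mulmx Z (differentiable_linear_mx X (@lV n.+1)) (dsoft X)).
rewrite (mulmxA _ Z) (mulmxA _ X) jacE; last exact: differentiable_softmax.
congr (_ + _); congr (_ *m _); first exact: (diff_linear_mx X Z (@lV n.+1)).
exact: diff_compE (differentiable_scores X) (differentiable_softmax _).
Qed.

Lemma jac_headE N (n : 'I_N) (X : 'M[R]_(d, N)) v :
  jac_head WQ WK WV rope h n X *m v =
  'd (head_last WQ WK WV rope h) (Defs.prefix n X) (unvec v).
Proof.
have dun := differentiable_linear_mx (vec (Defs.prefix n X))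
  (@linear_unvec R d n.+1).
have dh := differentiable_head_last (unvec (vec (Defs.prefix n X))).
rewrite jacE; last exact: differentiable_comp dun dh.
rewrite (diff_compE v dun dh) vecK; congr ('d _ _ _).
exact: (diff_linear_mx _ _ (@linear_unvec R d n.+1)).
Qed.

End Head.

(** One head per column, so that [vec] yields the concatenation of the heads on which [WO] acts. *)
Definition heads {N} (n : 'I_N) (X : 'M[R]_(d, N)) : 'M[R]_(dhead, nhead) :=
  \matrix_(j, h) head_last WQ WK WV rope h (Defs.prefix n X) j 0.

Lemma differentiable_head_prefix h N (n : 'I_N) (X : 'M[R]_(d, N)) :
  differentiable (fun X => head_last WQ WK WV rope h (Defs.prefix n X)) X.
Proof.
exact: differentiable_comp (differentiable_linear_mx _ (linear_prefix _))
  (differentiable_head_last _ _).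
Qed.

Let heads_entryE N (n : 'I_N) j h :
  (fun X => heads n X j h) =
  (fun X => head_last WQ WK WV rope h (Defs.prefix n X) j 0).
Proof. by apply/funext => X; rewrite mxE. Qed.

Lemma differentiable_heads N (n : 'I_N) X : differentiable (heads n) X.
Proof.
apply: differentiable_mx => j h; rewrite heads_entryE.
exact/differentiable_entry/differentiable_head_prefix.
Qed.

(** Causality: restriction to the first tokens is linear, so a perturbation enters only through its
    own prefix. *)
Lemma diff_heads N (n : 'I_N) X Z j h :
  ('d (heads n) X Z) j h =
  ('d (head_last WQ WK WV rope h) (Defs.prefix n X) (Defs.prefix n Z)) j 0.
Proof.
rewrite (diff_entry _ _ _ (differentiable_heads n X)) heads_entryE.
rewrite -(diff_entry _ _ _ (differentiable_head_prefix h n X)).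
have dp := differentiable_linear_mx X (linear_prefix n).
rewrite (diff_compE Z dp (differentiable_head_last h (Defs.prefix n X))).
by rewrite (diff_linear_mx _ _ (linear_prefix n)).
Qed.

Let lO : linear (fun A : 'M[R]_(dhead, nhead) => WO *m vec A).
Proof. by move=> a A B; rewrite linear_vec linearP. Qed.

Let dO N (n : 'I_N) X : differentiable (fun X => WO *m vec (heads n X)) X.
Proof.
exact: differentiable_comp (differentiable_heads n X)
  (differentiable_linear_mx _ lO).
Qed.

Let attention_entryE N (n : 'I_N) i :
  (fun X => attention WQ WK WV WO rope X i n) =
  (fun X => (WO *m vec (heads n X)) i 0).
Proof. by apply/funext => X; rewrite mxE. Qed.

Lemma differentiable_attention N (X : 'M[R]_(d, N)) :
  differentiable (attention WQ WK WV WO rope) X.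
Proof.
apply: differentiable_mx => i n; rewrite attention_entryE.
exact/differentiable_entry/dO.
Qed.

(** Each output column is a fixed linear map applied to the heads of that token, so differentiation
    passes through [WO] and [vec]. *)
Lemma col_diff_attention N (n : 'I_N) (X Z : 'M[R]_(d, N)) :
  col n ('d (attention WQ WK WV WO rope) X Z) =
  WO *m vec ('d (heads n) X Z).
Proof.
apply/colP => i; rewrite mxE.
rewrite (diff_entry _ _ _ (differentiable_attention X)) attention_entryE.
rewrite -(diff_entry _ _ _ (dO n X)).
have dL := differentiable_linear_mx (heads n X) lO.
by rewrite (diff_compE Z (differentiable_heads n X) dL) (diff_linear_mx _ _ lO).
Qed.

Lemma jac_attentionE N (X : 'M[R]_(d, N)) v :
  jac (fun v : 'cV[R]_(N * d) => vec (attention WQ WK WV WO rope (unvec v)))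
    (vec X) *m v = vec ('d (attention WQ WK WV WO rope) X (unvec v)).
Proof.
have dun := differentiable_linear_mx (vec X) (@linear_unvec R d N).
have dA := differentiable_attention (unvec (vec X)).
have dAun := differentiable_comp dun dA.
have dv := differentiable_linear_mx
  (attention WQ WK WV WO rope (unvec (vec X))) (@linear_vec R d N).
rewrite jacE; last exact: differentiable_comp dAun dv.
rewrite (diff_compE v dAun dv) (diff_linear_mx _ _ (@linear_vec R d N)).
rewrite (diff_compE v dun dA) (diff_linear_mx _ _ (@linear_unvec R d N)).
by rewrite vecK.
Qed.

End AttentionCalculus.

(** * Finite-dimensional lp norms *)

Section LpNorm.
Context {R : realType}.
Implicit Types p : \bar R.
Local Notation conj := hoelder_conjugate.

(** Separates the endpoints, where the two norms are a maximum and a sum, from the interior, where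
    both exponents are finite and Young's inequality is available. *)
Lemma hoelder_conjugate_cases p : (1 <= p)%E ->
  [\/ p = +oo%E /\ conj p = 1%E, p = 1%E /\ conj p = +oo%E |
      exists r s : R, [/\ p = r%:E, conj p = s%:E, 1 < r, 1 < s &
                          r^-1 + s^-1 = 1]].
Proof.
case: p => [r| |//]; last first.
  by move=> _; constructor 1; rewrite hoelder_conjugatey.
rewrite lee_fin le_eqVlt => /predU1P[<-|r1].
  by constructor 2; rewrite hoelder_conjugate1.
have r0 : 0 < r by apply: lt_trans r1.
constructor 3; exists r, (r / (r - 1)).
have r10 : r - 1 != 0 by rewrite subr_eq0 gt_eqF.
split => //.
- by rewrite /hoelder_conjugate /= eqe (gt_eqF r0) -EFinB inver (negbTE r10).
- by rewrite ltr_pdivlMr ?subr_gt0 // mul1r ltrBlDr ltrDl.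
- by rewrite invf_div mulrBl mulfV ?gt_eqF // mul1r addrC subrK.
Qed.

Lemma lpnorm1 n (x : 'cV[R]_n) : lpnorm 1%E x = \sum_i `|x i 0|.
Proof.
rewrite /= invr1 powRr1; last by apply: sumr_ge0 => i _; exact: powR_ge0.
by apply: eq_bigr => i _; rewrite powRr1.
Qed.

Lemma lpnorm_ge0 n p (x : 'cV[R]_n) : 0 <= lpnorm p x.
Proof.
by case: p => [r| |] //=; [exact: powR_ge0|exact: bigmax_ge_id].
Qed.

Lemma entry_le_lpnorm n p (x : 'cV[R]_n) i :
  (1 <= p)%E -> `|x i 0| <= lpnorm p x.
Proof.
case: p => [r| |//] /=; last by move=> _; exact: le_bigmax.
rewrite lee_fin => r1; have r0 : 0 < r by apply: lt_le_trans r1.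
have -> : `|x i 0| = (`|x i 0| `^ r) `^ r^-1.
  by rewrite -powRrM mulfV ?gt_eqF // powRr1.
apply: ge0_ler_powR; rewrite ?invr_ge0 ?(ltW r0) // ?nnegrE ?powR_ge0 //.
  by apply: sumr_ge0 => k _; exact: powR_ge0.
by rewrite (bigD1 i) //= lerDl; apply: sumr_ge0 => k _; exact: powR_ge0.
Qed.

Lemma sum_normalized_powR n (r : R) (x : 'cV[R]_n) : 1 < r ->
  lpnorm r%:E x != 0 -> \sum_i (`|x i 0| / lpnorm r%:E x) `^ r = 1.
Proof.
move=> r1 x0; have r0 : 0 < r by apply: lt_trans r1.
have N0 : 0 <= lpnorm r%:E x := lpnorm_ge0 _ _.
under eq_bigr do rewrite powRM ?invr_ge0 //.
rewrite -mulr_suml.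
have -> : \sum_i `|x i 0| `^ r = lpnorm r%:E x `^ r.
  rewrite /= -powRrM mulVf ?gt_eqF // powRr1 //.
  by apply: sumr_ge0 => k _; exact: powR_ge0.
by rewrite -powRM ?invr_ge0 // mulfV // powR1.
Qed.

(** At the endpoints one factor is bounded by its maximum. In the interior both vectors are
    normalised and Young's inequality is summed over the entries. *)
Lemma hoelder_sum n p (x y : 'cV[R]_n) : (1 <= p)%E ->
  \sum_i `|x i 0 * y i 0| <= lpnorm p x * lpnorm (conj p) y.
Proof.
move=> /hoelder_conjugate_cases[[-> ->]|[-> ->]|[r [s [-> -> r1 s1 rs]]]].
- rewrite lpnorm1 mulr_sumr; apply: ler_sum => i _; rewrite normrM.
  by apply: ler_wpM2r => //; exact/entry_le_lpnorm/leey.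
- rewrite lpnorm1 mulr_suml; apply: ler_sum => i _; rewrite normrM.
  by apply: ler_wpM2l => //; exact/entry_le_lpnorm/leey.
have r0 : 0 < r by apply: lt_trans r1.
have s0 : 0 < s by apply: lt_trans s1.
(* Normalisation divides by the norms, so vanishing norms are treated first: they force every entry
   to vanish. *)
have [x0|xN0] := eqVneq (lpnorm r%:E x) 0.
  rewrite x0 mul0r big1 // => i _.
  have := @entry_le_lpnorm _ r%:E x i; rewrite x0 lee_fin => /(_ (ltW r1)).
  by rewrite normr_le0 => /eqP ->; rewrite mul0r normr0.
have [y0|yN0] := eqVneq (lpnorm s%:E y) 0.
  rewrite y0 mulr0 big1 // => i _.
  have := @entry_le_lpnorm _ s%:E y i; rewrite y0 lee_fin => /(_ (ltW s1)).
  by rewrite normr_le0 => /eqP ->; rewrite mulr0 normr0.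
have := sum_normalized_powR r1 xN0; have := sum_normalized_powR s1 yN0.
have a0 : 0 < lpnorm r%:E x by rewrite lt_neqAle eq_sym xN0 lpnorm_ge0.
have b0 : 0 < lpnorm s%:E y by rewrite lt_neqAle eq_sym yN0 lpnorm_ge0.
move: (lpnorm r%:E x) (lpnorm s%:E y) a0 b0 {xN0 yN0} => a b a0 b0 sy sx.
(* After division by [a * b] the right-hand side is 1, written as [r^-1 + s^-1]; each summand is
   then multiplied by a normalised power sum equal to 1, which leaves Young's inequality
   termwise. *)
rewrite -[a * b]mulr1 -ler_pdivrMl ?mulr_gt0 // mulr_sumr -rs.
rewrite -[r^-1]mul1r -[s^-1]mul1r.
rewrite -{1}sx -sy !mulr_suml -big_split /=; apply: ler_sum => i _.
have -> : (a * b)^-1 * `|x i 0 * y i 0| = (`|x i 0| / a) * (`|y i 0| / b).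
  by rewrite normrM invfM mulrACA [a^-1 * _]mulrC [b^-1 * _]mulrC.
by apply: conjugate_powR => //; rewrite divr_ge0 // ltW.
Qed.

Lemma lpnorm0 n p : (1 <= p)%E -> lpnorm p (0 : 'cV[R]_n) = 0.
Proof.
case: p => [r| |//] /=; rewrite ?lee_fin => r1.
  have r0 : 0 < r by apply: lt_le_trans r1.
  rewrite big1 ?powR0 ?invr_neq0 ?gt_eqF // => i _.
  by rewrite mxE normr0 powR0 // gt_eqF.
apply/eqP; rewrite eq_le bigmax_ge_id andbT.
by apply: bigmax_le => // i _; rewrite mxE normr0.
Qed.

Lemma lpnorm_delta1 n (i : 'I_n) (a : R) :
  lpnorm 1%E (a *: delta_mx i 0 : 'cV[R]_n) = `|a|.
Proof.
rewrite lpnorm1 (bigD1 i) //= big1 => [|k ki]; last first.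
  by rewrite !mxE (negbTE ki) mulr0 normr0.
by rewrite !mxE !eqxx mulr1 addr0.
Qed.

(** The witness is the sign vector of [y] for infinite [p], a signed basis vector at an entry of
    largest modulus for [p = 1], and the normalised power [s - 1] of [y] with its signs in
    between. *)
Lemma hoelder_extremal n p (y : 'cV[R]_n) : (1 <= p)%E ->
  exists2 x : 'cV[R]_n,
    lpnorm p x <= 1 & \sum_i x i 0 * y i 0 = lpnorm (conj p) y.
Proof.
move=> p1.
case: (hoelder_conjugate_cases p1) =>
  [[-> ->]|[-> ->]|[r [s [-> -> r1 s1 rs]]]].
- exists (\col_i Num.sg (y i 0)).
    apply: bigmax_le => // i _; rewrite mxE normr_sg; by case: (_ != 0).
  by rewrite lpnorm1; apply: eq_bigr => i _; rewrite mxE -normrEsg.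
(* A largest entry exists only in positive dimension; in dimension 0 both sides are 0. *)
- case: n y => [|n] y.
    exists 0; first by rewrite lpnorm0.
    by rewrite big_ord0 /= big_ord0.
  have [i _ e] : exists2 i, true & lpnorm +oo%E y = `|y i 0|.
    by exists [arg max_(i > ord0) `|y i 0|]%O => //=; apply: bigmax_eq_arg.
  exists (Num.sg (y i 0) *: delta_mx i 0).
    by rewrite lpnorm_delta1 normr_sg; case: (_ != 0).
  rewrite e (bigD1 i) //= big1 => [|k ki]; last first.
    by rewrite !mxE (negbTE ki) mulr0 mul0r.
  by rewrite !mxE !eqxx mulr1 addr0 -normrEsg.
have [y0|yN0] := eqVneq (lpnorm s%:E y) 0.
  exists 0; first by rewrite lpnorm0 // lee_fin ltW.
  by rewrite y0 big1 // => i _; rewrite mxE mul0r.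
set N := lpnorm s%:E y.
have N0 : 0 < N by rewrite lt_neqAle eq_sym yN0 lpnorm_ge0.
have r0 : 0 < r by apply: lt_trans r1.
have s0 : 0 < s by apply: lt_trans s1.
(* Conjugacy of the exponents turns the [r]-th powers of the witness into the [s]-th powers of the
   normalised [y], whose sum is 1. *)
have sr : (s - 1) * r = s.
  have : (s - 1) / s = r^-1 by rewrite mulrBl mulfV ?gt_eqF // mul1r -rs addrK.
  move/(congr1 ( *%R^~ (r * s))); rewrite mulrCA mulfVK ?gt_eqF //.
  by rewrite mulKf ?gt_eqF // mulrC.
exists (\col_i (Num.sg (y i 0) * (`|y i 0| / N) `^ (s - 1))).
  have -> : lpnorm r%:E (\col_i (Num.sg (y i 0) * (`|y i 0| / N) `^ (s - 1)))
    = (\sum_i (`|y i 0| / N) `^ s) `^ r^-1.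
    congr (_ `^ _); apply: eq_bigr => i _; rewrite mxE normrM normr_sg.
    rewrite (ger0_norm (powR_ge0 _ _)).
    have [->|yi] := eqVneq (y i 0) 0.
      by rewrite normr0 !mul0r !powR0 ?gt_eqF.
    by rewrite mul1r -powRrM sr.
  by rewrite (sum_normalized_powR s1 yN0) powR1.
transitivity (N * \sum_i (`|y i 0| / N) `^ s); last first.
  by rewrite (sum_normalized_powR s1 yN0) mulr1.
rewrite mulr_sumr; apply: eq_bigr => i _; rewrite mxE.
(* With u the quotient of |y_i| by [N], the identity is |y_i| u^(s-1) = N u^s. *)
rewrite mulrAC -normrEsg -(mulr_powRB1 _ s0); last first.
  by rewrite divr_ge0 // ltW.
by rewrite mulrA [N * _]mulrC mulfVK // gt_eqF.
Qed.

Lemma lpnorm2_sqr n (x : 'cV[R]_n) : lpnorm 2%:E x ^+ 2 = (x^T *m x) 0 0.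
Proof.
rewrite mxE /= -powR_mulrn ?powR_ge0 // -powRrM mulVf // powRr1; last first.
  by apply: sumr_ge0 => i _; exact: powR_ge0.
by apply: eq_bigr => i _; rewrite mxE -expr2 powR_mulrn // real_normK ?num_real.
Qed.

Lemma lpnorm2_orthogonal n (Q : 'M[R]_n) (x : 'cV[R]_n) : Q^T *m Q = 1%:M ->
  lpnorm 2%:E (Q *m x) = lpnorm 2%:E x.
Proof.
have lpnorm2E (y : 'cV[R]_n) : lpnorm 2%:E y = Num.sqrt ((y^T *m y) 0 0).
  by rewrite -lpnorm2_sqr sqrtr_sqr ger0_norm // lpnorm_ge0.
by move=> QQ; rewrite !lpnorm2E trmx_mul -mulmxA (mulmxA Q^T) QQ mul1mx.
Qed.

Lemma dot_sym n (u w : 'cV[R]_n) : (u^T *m w) 0 0 = (w^T *m u) 0 0.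
Proof. by rewrite !mxE; apply: eq_bigr => i _; rewrite !mxE mulrC. Qed.

Lemma hoelder_dot n p (x y : 'cV[R]_n) : (1 <= p)%E ->
  `|(x^T *m y) 0 0| <= lpnorm p x * lpnorm (conj p) y.
Proof.
move=> p1; apply: le_trans (hoelder_sum x y p1).
rewrite mxE; apply: le_trans (ler_norm_sum _ _ _) _.
by apply: ler_sum => i _; rewrite mxE.
Qed.

Lemma cauchy_schwarz_dot n (x y : 'cV[R]_n) :
  `|(x^T *m y) 0 0| <= lpnorm 2%:E x * lpnorm 2%:E y.
Proof.
by rewrite -{2}hoelder_conjugate2; apply: hoelder_dot; rewrite lee_fin ler1n.
Qed.

End LpNorm.

(** * Operator norms *)

Section VectorNorm.
Context {R : realType}.

(** A common interface for the lp norms and the block norms. The bound on entries gives definiteness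
    and makes the supremum in [opnorm] finite. *)
Record vnorm n (nu : 'cV[R]_n -> R) : Prop := VNorm {
  vnorm_ge0 : forall x, 0 <= nu x;
  vnormZ_le : forall a (x : 'cV[R]_n), nu (a *: x) <= `|a| * nu x;
  vnormD_le : forall x y : 'cV[R]_n, nu (x + y) <= nu x + nu y;
  entry_le_vnorm : forall (x : 'cV[R]_n) i, `|x i 0| <= nu x }.

Lemma mulmx_sum_col n m (A : 'M[R]_(n, m)) (x : 'cV[R]_m) :
  A *m x = \sum_j x j 0 *: col j A.
Proof.
apply/colP => i; rewrite !mxE summxE; apply: eq_bigr => j _.
by rewrite !mxE mulrC.
Qed.

Section Theory.
Context {n : nat} {nu : 'cV[R]_n -> R}.
Hypothesis nuP : vnorm nu.

Lemma vnorm0 : nu 0 = 0.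
Proof.
apply/eqP; rewrite eq_le (vnorm_ge0 nuP) andbT -[X in nu X](scale0r 0).
by apply: le_trans (vnormZ_le nuP _ _) _; rewrite normr0 mul0r.
Qed.

Lemma vnorm_eq0 x : nu x = 0 -> x = 0.
Proof.
move=> x0; apply/colP => i; rewrite mxE; apply/eqP.
by rewrite -normr_le0 -x0; exact: entry_le_vnorm nuP _ _.
Qed.

Lemma vnorm_sum_le (I : Type) (r : seq I) (F : I -> 'cV[R]_n) :
  nu (\sum_(i <- r) F i) <= \sum_(i <- r) nu (F i).
Proof.
elim/big_ind2 : _ => [|x1 x2 y1 y2 h1 h2|//]; first by rewrite vnorm0.
by apply: le_trans (vnormD_le nuP _ _) _; exact: lerD.
Qed.

(** The product combines the columns of [A] with coefficients of total modulus [lpnorm 1%E x]. It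
    serves for the softmax weights and for the image of the softmax Jacobian. *)
Lemma vnorm_mulmx_le m (A : 'M[R]_(n, m)) (x : 'cV[R]_m) (B : R) :
  (forall j, nu (col j A) <= B) -> nu (A *m x) <= B * lpnorm 1%E x.
Proof.
move=> AB; rewrite mulmx_sum_col; apply: le_trans (vnorm_sum_le _ _) _.
rewrite lpnorm1 mulr_sumr; apply: ler_sum => j _.
apply: le_trans (vnormZ_le nuP _ _) _.
by rewrite mulrC; apply: ler_wpM2r.
Qed.

End Theory.

Section OperatorNorm.
Context {m n : nat} {nu : 'cV[R]_n -> R} {mu : 'cV[R]_m -> R}.
Hypotheses (nuP : vnorm nu) (muP : vnorm mu).
Implicit Type A : 'M[R]_(m, n).

(** Needed for [sup] to be a genuine supremum. On the unit ball all entries are at most 1 in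
    modulus, so the sum of the norms of the columns is an upper bound. *)
Lemma opnorm_has_sup A :
  has_sup [set mu (A *m x) | x in [set x | nu x <= 1]]%classic.
Proof.
split; first by exists (mu (A *m 0)), 0 => //=; rewrite vnorm0.
exists (\sum_j mu (col j A)) => _ [x /= x1 <-].
rewrite mulmx_sum_col; apply: le_trans (vnorm_sum_le muP _ _) _.
apply: ler_sum => j _; apply: le_trans (vnormZ_le muP _ _) _.
apply: ler_piMl; first exact: vnorm_ge0.
exact: le_trans (entry_le_vnorm nuP _ _) x1.
Qed.

Lemma opnorm_ub1 A x : nu x <= 1 -> mu (A *m x) <= opnorm nu mu A.
Proof.
move=> x1; apply: sup_ubound; first exact: (opnorm_has_sup A).2.
by exists x.
Qed.

Lemma opnorm_ge0 A : 0 <= opnorm nu mu A.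
Proof.
apply: le_trans (vnorm_ge0 muP (A *m 0)) _.
by apply: opnorm_ub1; rewrite vnorm0.
Qed.

(** Rescaling to the unit sphere; a vector of norm 0 is zero and is treated apart. *)
Lemma opnorm_ub A x : mu (A *m x) <= opnorm nu mu A * nu x.
Proof.
have [x0|xN0] := eqVneq (nu x) 0.
  by rewrite x0 (vnorm_eq0 nuP x0) mulmx0 vnorm0 // mulr0.
have xgt0 : 0 < nu x by rewrite lt_neqAle eq_sym xN0 vnorm_ge0.
have {1}-> : x = nu x *: ((nu x)^-1 *: x) by rewrite scalerA mulfV // scale1r.
rewrite -scalemxAr mulrC; apply: le_trans (vnormZ_le muP _ _) _.
rewrite (gtr0_norm xgt0) ler_pM2l //; apply: opnorm_ub1.
apply: le_trans (vnormZ_le nuP _ _) _.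
by rewrite gtr0_norm ?invr_gt0 // mulVf.
Qed.

Lemma opnorm_le A B : (forall x, nu x <= 1 -> mu (A *m x) <= B) ->
  opnorm nu mu A <= B.
Proof.
move=> AB; apply: sup_le_ub; first exact: (opnorm_has_sup A).1.
by move=> _ [x /= x1 <-]; exact: AB.
Qed.

End OperatorNorm.

(** By duality the norm of [x] is the largest pairing of [x] with the unit ball of the conjugate
    norm, and pairings are linear in [x]. The extremal vector is taken at the conjugate exponent,
    whose conjugate is [p] again. *)
Lemma lpnorm_vnorm n (p : \bar R) : (1 <= p)%E -> vnorm (@lpnorm R n p).
Proof.
move=> p1; have q1 := hoelder_conj_ge1 p1.
have qp := hoelder_conjugateK p.
have dot_le (z x : 'cV[R]_n) : lpnorm (hoelder_conjugate p) z <= 1 ->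
    `|\sum_i z i 0 * x i 0| <= lpnorm p x :> R.
  move=> z1; apply: le_trans (ler_norm_sum _ _ _) _.
  apply: le_trans (hoelder_sum (p := hoelder_conjugate p) z x q1) _.
  by rewrite qp; apply: ler_piMl => //; exact: lpnorm_ge0.
split=> [x|a x|x y|x i].
- exact: lpnorm_ge0.
- have [z z1] := hoelder_extremal (a *: x) q1; rewrite qp => <-.
  apply: le_trans (ler_norm _) _.
  rewrite (eq_bigr (fun i => a * (z i 0 * x i 0))) => [|i _]; last first.
    by rewrite mxE mulrCA.
  by rewrite -mulr_sumr normrM; apply: ler_wpM2l => //; exact: dot_le.
- have [z z1] := hoelder_extremal (x + y) q1; rewrite qp => <-.
  rewrite (eq_bigr (fun i => z i 0 * x i 0 + z i 0 * y i 0)) => [|i _];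
    last first.
    by rewrite mxE mulrDr.
  rewrite big_split; apply: le_trans (ler_norm _) _.
  by apply: le_trans (ler_normD _ _) _; apply: lerD; exact: dot_le.
- exact: entry_le_lpnorm.
Qed.

Lemma blocknorm_vnorm m k (p : \bar R) : (1 <= p)%E ->
  vnorm (@blocknorm R m k p).
Proof.
move=> p1; have lpP := @lpnorm_vnorm k p p1.
pose blk (x : 'cV[R]_(m * k)) b := \col_(i < k) x (mxvec_index b i) 0.
have blk_le x b : lpnorm p (blk x b) <= blocknorm p x.
  exact: (le_bigmax 0 (fun b => lpnorm p (blk x b)) b).
have ge0 x : 0 <= @blocknorm R m k p x by exact: bigmax_ge_id.
split=> // [a x|x y|x i].
- apply: bigmax_le => [|b _]; first exact: mulr_ge0.
  have -> : \col_i (a *: x) (mxvec_index b i) 0 = a *: blk x b.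
    by apply/colP => i; rewrite !mxE.
  by apply: le_trans (vnormZ_le lpP _ _) _; apply: ler_wpM2l.
- apply: bigmax_le => [|b _]; first exact: addr_ge0.
  have -> : \col_i (x + y) (mxvec_index b i) 0 = blk x b + blk y b.
    by apply/colP => i; rewrite !mxE.
  by apply: le_trans (vnormD_le lpP _ _) _; apply: lerD.
(* Every index of the long vector is entry [j] of some block [b]. *)
- case/mxvec_indexP: i => b j; apply: le_trans (blk_le x b).
  by have := entry_le_vnorm lpP (blk x b) j; rewrite mxE.
Qed.

(** The blocks of [vec A] are the columns of [A]. The hypothesis [0 <= B] accounts for the default
    value 0 of the maximum. *)
Lemma blocknorm_vecP n k (p : \bar R) (A : 'M[R]_(k, n)) (B : R) : 0 <= B ->
  (blocknorm p (vec A) <= B) <-> (forall j, lpnorm p (col j A) <= B).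
Proof.
move=> B0.
have colE j : \col_i vec A (mxvec_index j i) 0 = col j A.
  by apply/colP => i; rewrite mxE vecE mxE.
split=> [+ j|AB]; last by apply: bigmax_le => // j _; rewrite colE.
apply: le_trans; rewrite -colE.
exact: (le_bigmax 0 (fun j => lpnorm p (\col_i vec A (mxvec_index j i) 0)) j).
Qed.

(** A column is the image of a basis vector, which has l1 norm 1. *)
Lemma col_le_lpopnorm m n (p : \bar R) (A : 'M[R]_(m, n)) j : (1 <= p)%E ->
  lpnorm p (col j A) <= lpopnorm 1%E p A.
Proof.
move=> p1; rewrite colE.
apply: (opnorm_ub1 (lpnorm_vnorm _ (lexx 1%E)) (lpnorm_vnorm _ p1)).
by rewrite -[delta_mx _ _]scale1r lpnorm_delta1 normr1.
Qed.

Lemma lpopnorm_ge0 m n (p q : \bar R) (A : 'M[R]_(m, n)) :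
  (1 <= p)%E -> (1 <= q)%E -> 0 <= lpopnorm p q A.
Proof. by move=> p1 q1; apply: opnorm_ge0; exact: lpnorm_vnorm. Qed.

Lemma lpopnorm_ub m n (p q : \bar R) (A : 'M[R]_(m, n)) x :
  (1 <= p)%E -> (1 <= q)%E -> lpnorm q (A *m x) <= lpopnorm p q A * lpnorm p x.
Proof. by move=> p1 q1; apply: opnorm_ub; exact: lpnorm_vnorm. Qed.

(** The conjugate norm is attained on some [x] in the unit ball; moving [A] across the pairing
    leaves the dot product of [A *m x] and [w], bounded by Cauchy-Schwarz. *)
Lemma lpnorm_conjugate_trmx_le k n p (A : 'M[R]_(k, n)) (w : 'cV[R]_k) :
  (1 <= p)%E ->
  lpnorm (hoelder_conjugate p) (A^T *m w) <= lpopnorm p 2%:E A * lpnorm 2%:E w.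
Proof.
move=> p1; have two : (1 <= 2%:E :> \bar R)%E by rewrite lee_fin ler1n.
have [x x1 <-] := hoelder_extremal (A^T *m w) p1.
have -> : \sum_i x i 0 * (A^T *m w) i 0 = ((A *m x)^T *m w) 0 0.
  rewrite trmx_mul -mulmxA [RHS]mxE; apply: eq_bigr => i _.
  by congr (_ * _); rewrite mxE.
apply: le_trans (ler_norm _) _; apply: le_trans (cauchy_schwarz_dot _ _) _.
apply: ler_wpM2r; first exact: lpnorm_ge0.
apply: le_trans (lpopnorm_ub A x p1 two) _.
by apply: ler_piMr => //; exact: lpopnorm_ge0.
Qed.

Lemma lpopnorm_trmx_mul_le k m n p
    (A : 'M[R]_(k, m)) (B : 'M[R]_(k, n)) : (1 <= p)%E ->
  lpopnorm p (hoelder_conjugate p) (A^T *m B) <=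
  lpopnorm p 2%:E A * lpopnorm p 2%:E B.
Proof.
move=> p1; have two : (1 <= 2%:E :> \bar R)%E by rewrite lee_fin ler1n.
have q1 := hoelder_conj_ge1 p1.
apply: opnorm_le => [||z z1]; [exact: lpnorm_vnorm|exact: lpnorm_vnorm|].
rewrite -mulmxA; apply: le_trans (lpnorm_conjugate_trmx_le _ _ p1) _.
apply: ler_wpM2l; first exact: lpopnorm_ge0.
apply: le_trans (lpopnorm_ub B z p1 two) _.
by apply: ler_piMr => //; exact: lpopnorm_ge0.
Qed.

Lemma lpnorm1_softmax n (b : 'cV[R]_n.+1) : lpnorm 1%E (softmax b) = 1.
Proof.
have S0 := sum_expR_gt0 b; rewrite lpnorm1.
under eq_bigr do rewrite mxE ger0_norm ?divr_ge0 ?expR_ge0 ?ltW //.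
by rewrite -mulr_suml mulfV // gt_eqF.
Qed.

End VectorNorm.

(** * Norm bounds *)

Section AttentionBounds.
Context {R : realType} {nhead dhead N : nat}.
Local Notation d := (nhead * dhead)%N.
Variables (WQ WK WV WO : 'M[R]_d) (rope : int -> 'M[R]_dhead).
Variable X : 'M[R]_(d, N).

Lemma jac_head_le h p q n (Z : 'M[R]_(d, N)) : (1 <= p)%E -> (1 <= q)%E ->
  (forall j, lpnorm p (col j Z) <= 1) ->
  lpnorm q ('d (head_last WQ WK WV rope h) (Defs.prefix n X) (Defs.prefix n Z))
    <= cond_head p q WQ WK WV rope h X.
Proof.
move=> p1 q1 Z1.
apply: le_trans (le_bigmax 0
  (fun n => opnorm (blocknorm p) (lpnorm q) (jac_head WQ WK WV rope h n X)) n).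
rewrite -[Defs.prefix n Z]vecK -jac_headE.
apply: opnorm_ub1; [exact: blocknorm_vnorm|exact: lpnorm_vnorm|].
apply/blocknorm_vecP => // j.
have -> : col j (Defs.prefix n Z) = col (widen_ord (ltn_ord n) j) Z.
  by apply/colP => i; rewrite !mxE.
exact: Z1.
Qed.

(** A column of the derivative is [WO] applied to the stacked derivatives of the heads. Each of
    these blocks is bounded by the condition number of its head, which is why [WO] is measured from
    the block norm. *)
Lemma cond_attention_le p q : (1 <= p)%E -> (1 <= q)%E ->
  cond_attention p q WQ WK WV WO rope X
    <= opnorm (@blocknorm R nhead dhead q) (lpnorm q) WO
       * \big[Num.max/0]_(h < nhead) cond_head p q WQ WK WV rope h X.
Proof.
move=> p1 q1.
have bP m k (r : \bar R) : (1 <= r)%E -> vnorm (@blocknorm R m k r).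
  exact: blocknorm_vnorm.
set M := \big[_/_]_(_ < _) _.
have M0 : 0 <= M by exact: bigmax_ge_id.
have O0 := opnorm_ge0 (bP nhead dhead q q1) (lpnorm_vnorm d q1) WO.
apply: opnorm_le => [||v v1]; [exact: bP|exact: bP|].
rewrite jac_attentionE; apply/blocknorm_vecP => [|n]; first exact: mulr_ge0.
rewrite col_diff_attention.
apply: le_trans (opnorm_ub (bP _ _ _ q1) (lpnorm_vnorm _ q1) _ _) _.
apply: ler_wpM2l => //; apply/blocknorm_vecP => // h.
have -> : col h ('d (heads WQ WK WV rope n) X (unvec v)) =
    'd (head_last WQ WK WV rope h) (Defs.prefix n X) (Defs.prefix n (unvec v)).
  by apply/colP => j; rewrite mxE diff_heads.
apply: le_trans (le_bigmax 0 (fun h => cond_head p q WQ WK WV rope h X) h).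
apply: jac_head_le => // j; move: j; apply/blocknorm_vecP => //.
by rewrite unvecK.
Qed.

Section Head.
Variable h : 'I_nhead.
Local Notation V := (head_rows WV h).
Local Notation K := (head_rows WK h).
Local Notation Q := (head_rows WQ h).
Local Notation kappaS := (cond_softmax WQ WK rope h X).

Lemma cond_softmax_ge0 : 0 <= kappaS.
Proof. exact: bigmax_ge_id. Qed.

(** Common source of the four bounds on a head, with and without RoPE or a dominant row: [A] bounds
    the values, and [F] the two bilinear forms in the derivative of a score. Here [i] is the query
    token, [j] the key token, and [z], [z'] are columns of the perturbation. *)
Lemma cond_head_le p q (A F : R) : (1 <= p)%E -> (1 <= q)%E ->
  0 <= A -> 0 <= F ->
  (forall j, lpnorm q (V *m col j X) <= A) ->
  (forall s t z z' i j, lpnorm p z <= 1 -> lpnorm p z' <= 1 ->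
    `|((rope s *m (K *m z))^T *m (rope t *m (Q *m col i X))) 0 0| +
    `|((rope s *m (K *m col j X))^T *m (rope t *m (Q *m z'))) 0 0| <= F) ->
  cond_head p q WQ WK WV rope h X <=
    lpopnorm p q V + kappaS * A * ((Num.sqrt dhead%:R)^-1 * F).
Proof.
move=> p1 q1 A0 F0 VA KQ.
have c0 : 0 <= (Num.sqrt dhead%:R)^-1 :> R by rewrite invr_ge0 sqrtr_ge0.
have V0 : 0 <= lpopnorm p q V by exact: lpopnorm_ge0.
have lpP := lpnorm_vnorm _ p1; have lqP := lpnorm_vnorm _ q1.
have cE0 := mulr_ge0 c0 F0; have S0 := cond_softmax_ge0.
apply: bigmax_le => [|n _]; first by rewrite addr_ge0 // mulr_ge0 // mulr_ge0.
apply: opnorm_le => [||v v1]; [exact: blocknorm_vnorm|exact: lpnorm_vnorm|].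
rewrite jac_headE diff_head_last.
have {v1}Z1 j : lpnorm p (col j (unvec v)) <= 1.
  by move: j; apply/blocknorm_vecP => //; rewrite unvecK.
move: (unvec v) Z1 => Z Z1 {v}.
have colX j : col j (Defs.prefix n X) = col (widen_ord (ltn_ord n) j) X.
  by apply/colP => i; rewrite !mxE.
apply: le_trans (vnormD_le (lqP _) _ _) _; apply: lerD.
  (* First term: the columns of [Z] lie in the unit ball and are averaged with softmax weights, so
     the average does too. *)
  apply: le_trans (lpopnorm_ub _ _ p1 q1) _; apply: ler_piMr => //.
  apply: le_trans (vnorm_mulmx_le (lpP _) _ Z1) _.
  by rewrite lpnorm1_softmax mulr1.
rewrite mulmxA.
have VXA j : lpnorm q (col j (V *m Defs.prefix n X)) <= A.
  by rewrite colE -mulmxA -colE colX.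
(* Second term: the values contribute the factor [A], and there remains the l1 norm of the softmax
   Jacobian applied to the derivative of the scores. *)
apply: le_trans (vnorm_mulmx_le (lqP _) _ VXA) _.
rewrite [kappaS * A]mulrC -mulrA; apply: ler_wpM2l => //.
apply: le_trans (lpopnorm_ub _ _ (leey _) (lexx _)) _.
apply: ler_pM.
- by apply: lpopnorm_ge0; rewrite ?leey.
- exact: lpnorm_ge0.
- exact: (le_bigmax 0 (fun n => lpopnorm +oo%E 1%E
    (jac softmax (scores WQ WK rope h (Defs.prefix n X)))) n).
apply: bigmax_le => // t _.
rewrite diff_scores normrM ger0_norm //; apply: ler_wpM2l => //.
apply: le_trans (ler_normD _ _) _.
by rewrite /key /query !colX; exact: KQ.
Qed.

Lemma rope_dot_le s t (u w : 'cV[R]_dhead) : rope_group rope ->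
  `|((rope s *m u)^T *m (rope t *m w)) 0 0| <= lpnorm 2%:E u * lpnorm 2%:E w.
Proof.
move=> [orth _ _ _]; apply: le_trans (cauchy_schwarz_dot _ _) _.
by rewrite !lpnorm2_orthogonal.
Qed.

Lemma norope_dotE s t (u w : 'cV[R]_dhead) : (forall t, rope t = 1%:M) ->
  ((rope s *m u)^T *m (rope t *m w)) 0 0 = (u^T *m w) 0 0.
Proof. by move=> rope1; rewrite !rope1 !mul1mx. Qed.

(** Without rotations the two projections merge into one matrix. The dot product is first reversed
    so that this matrix is [Q^T *m K] and not its transpose. *)
Lemma norope_dot_le p (x z : 'cV[R]_d) : (1 <= p)%E ->
  `|((K *m z)^T *m (Q *m x)) 0 0| <=
  lpnorm p x * (lpopnorm p (hoelder_conjugate p) (Q^T *m K) * lpnorm p z).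
Proof.
move=> p1; rewrite dot_sym trmx_mul -mulmxA.
apply: le_trans (hoelder_dot _ _ p1) _.
apply: ler_wpM2l; first exact: lpnorm_ge0.
by rewrite (mulmxA _ K z); apply: lpopnorm_ub => //; exact: hoelder_conj_ge1.
Qed.

Lemma cond_head_le_rope p q : (1 <= p)%E -> (1 <= q)%E -> rope_group rope ->
  cond_head p q WQ WK WV rope h X <= lpopnorm p q V *
    (1 + kappaS * M_rope p WQ WK h * lpopnorm 1%E p X ^+ 2).
Proof.
move=> p1 q1 rope_grp.
have two : (1 <= 2%:E :> \bar R)%E by rewrite lee_fin ler1n.
have V0 : 0 <= lpopnorm p q V by exact: lpopnorm_ge0.
have K0 : 0 <= lpopnorm p 2%:E K by exact: lpopnorm_ge0.
have Q0 : 0 <= lpopnorm p 2%:E Q by exact: lpopnorm_ge0.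
have X0 : 0 <= lpopnorm 1%E p X by exact: lpopnorm_ge0.
have XP j : lpnorm p (col j X) <= lpopnorm 1%E p X by exact: col_le_lpopnorm.
have mul_le k r (W : 'M[R]_(k, d)) x B : (1 <= r)%E ->
    lpnorm p x <= B -> lpnorm r (W *m x) <= lpopnorm p r W * B.
  move=> r1 xB; apply: le_trans (lpopnorm_ub W x p1 r1) _.
  by apply: ler_wpM2l => //; exact: lpopnorm_ge0.
apply: le_trans.
  (* The factor 2 counts the two bilinear forms, each bounded by the norms of [Q], [K] and one
     token, the other argument lying in the unit ball. *)
  apply: (@cond_head_le p q (lpopnorm p q V * lpopnorm 1%E p X)
    (2 * lpopnorm p 2%:E Q * lpopnorm p 2%:E K * lpopnorm 1%E p X)) => //.
  - exact: mulr_ge0.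
  - exact: mulr_ge0 (mulr_ge0 (mulr_ge0 (ler0n _ 2) Q0) K0) X0.
  - by move=> j; exact: mul_le.
  move=> s t z z' i j z1 z'1.
  have E (a b x : R) : 2 * a * b * x = b * 1 * (a * x) + b * x * (a * 1).
    by ring.
  rewrite E; apply: lerD; apply: le_trans (rope_dot_le _ _ _ _ rope_grp) _;
    by apply: ler_pM; rewrite ?lpnorm_ge0 //; exact: mul_le.
have E (v k c a b x : R) : v + k * (v * x) * (c * (2 * a * b * x)) =
    v * (1 + k * (2 * c * a * b) * x ^+ 2) by ring.
by rewrite E.
Qed.

Lemma cond_head_le_norope p q : (1 <= p)%E -> (1 <= q)%E ->
  (forall t, rope t = 1%:M) ->
  cond_head p q WQ WK WV rope h X <= lpopnorm p q V *
    (1 + kappaS * M_norope p WQ WK h * lpopnorm 1%E p X ^+ 2).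
Proof.
move=> p1 q1 rope1; rewrite /M_norope.
set B := lpopnorm p (hoelder_conjugate p) _.
have V0 : 0 <= lpopnorm p q V by exact: lpopnorm_ge0.
have B0 : 0 <= B by apply: lpopnorm_ge0 => //; exact: hoelder_conj_ge1.
have X0 : 0 <= lpopnorm 1%E p X by exact: lpopnorm_ge0.
have XP j : lpnorm p (col j X) <= lpopnorm 1%E p X by exact: col_le_lpopnorm.
have dot_le (x z : 'cV[R]_d) a b : lpnorm p x <= a -> lpnorm p z <= b ->
    `|((K *m z)^T *m (Q *m x)) 0 0| <= a * (B * b).
  move=> xa zb; apply: le_trans (norope_dot_le _ _ p1) _.
  apply: (ler_pM (lpnorm_ge0 _ _) (mulr_ge0 B0 (lpnorm_ge0 _ _)) xa).
  exact: ler_wpM2l B0 _ _ zb.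
apply: le_trans.
  apply: (@cond_head_le p q (lpopnorm p q V * lpopnorm 1%E p X)
    (2 * B * lpopnorm 1%E p X)) => //.
  - exact: mulr_ge0.
  - exact: mulr_ge0 (mulr_ge0 (ler0n _ 2) B0) X0.
  - move=> j; apply: le_trans (lpopnorm_ub V _ p1 q1) _.
    by apply: ler_wpM2l.
  move=> s t z z' i j z1 z'1; rewrite !norope_dotE //.
  have E (b x : R) : 2 * b * x = x * (b * 1) + 1 * (b * x) by ring.
  by rewrite E; apply: lerD; exact: dot_le.
have E (v k c b x : R) : v + k * (v * x) * (c * (2 * b * x)) =
    v * (1 + k * (2 * c * b) * x ^+ 2) by ring.
by rewrite E.
Qed.

(** * Bounds for inputs with one dominant row *)

Section DominantRow.
Variables (i1 : 'I_d) (theta : R).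
Hypothesis theta0 : 0 <= theta.
Hypothesis Xtheta :
  forall i, i != i1 -> lpnorm +oo%E (row i X)^T <= theta.
Local Notation X1 := (lpopnorm 1%E +oo%E X).

(** [a] is the entry of the column in the dominant row, and [r] is the column with this entry
    replaced by 0. Quantifying over [W] lets one splitting serve all the projections. *)
Lemma col_dominant_row j : exists (a : R) (r : 'cV[R]_d),
  [/\ `|a| <= X1, lpnorm +oo%E r <= theta &
      forall m (W : 'M[R]_(m, d)), W *m col j X = a *: col i1 W + W *m r].
Proof.
exists (X i1 j), (col j X - X i1 j *: delta_mx i1 0); split.
- apply: le_trans (col_le_lpopnorm X j (leey _)).
  by have := entry_le_lpnorm (col j X) i1 (leey _); rewrite mxE.
- apply: bigmax_le => // i _; rewrite !mxE eqxx andbT.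
  have [->|ii1] := eqVneq i i1; first by rewrite mulr1 subrr normr0.
  rewrite mulr0 subr0; apply: le_trans (Xtheta ii1).
  by have := entry_le_lpnorm (row i X)^T j (leey _); rewrite !mxE.
- by move=> m W; rewrite mulmxBr -scalemxAr -colE addrC subrK.
Qed.

Lemma lpnorm_dominant_row k q (W : 'M[R]_(k, d)) j : (1 <= q)%E ->
  lpnorm q (W *m col j X) <=
  X1 * lpnorm q (col i1 W) + lpopnorm +oo%E q W * theta.
Proof.
move=> q1; have qP := @lpnorm_vnorm R k q q1.
have [a [r [aX rt ->]]] := col_dominant_row j.
apply: le_trans (vnormD_le qP _ _) _; apply: lerD.
  apply: le_trans (vnormZ_le qP _ _) _.
  by apply: ler_wpM2r => //; exact: lpnorm_ge0.
apply: le_trans (lpopnorm_ub W r (leey _) q1) _.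
by apply: ler_wpM2l => //; apply: lpopnorm_ge0; rewrite ?leey.
Qed.

Lemma cond_head_dominant_row_rope : rope_group rope ->
  cond_head +oo%E +oo%E WQ WK WV rope h X
    <= lpopnorm +oo%E +oo%E V
       + kappaS * (lpnorm +oo%E (col i1 V) * X1
                   + lpopnorm +oo%E +oo%E V * theta)
         * (mu_rope WQ WK h i1 * X1 + M_rope +oo%E WQ WK h * theta).
Proof.
move=> rope_grp; rewrite /mu_rope /M_rope.
have two : (1 <= 2%:E :> \bar R)%E by rewrite lee_fin ler1n.
have X0 : 0 <= X1 by apply: lpopnorm_ge0; rewrite ?leey.
set kn := lpopnorm +oo%E 2%:E K; set qn := lpopnorm +oo%E 2%:E Q.
have K0 : 0 <= kn by apply: lpopnorm_ge0; rewrite ?leey.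
have Q0 : 0 <= qn by apply: lpopnorm_ge0; rewrite ?leey.
set wk := lpnorm 2%:E (col i1 K); set wq := lpnorm 2%:E (col i1 Q).
have wk0 : 0 <= wk by exact: lpnorm_ge0.
have wq0 : 0 <= wq by exact: lpnorm_ge0.
have unit_le (W : 'M[R]_(dhead, d)) z : lpnorm +oo%E z <= 1 ->
    lpnorm 2%:E (W *m z) <= lpopnorm +oo%E 2%:E W.
  exact: opnorm_ub1 (lpnorm_vnorm _ (leey _)) (lpnorm_vnorm _ two) _ _.
apply: le_trans.
  (* Each bilinear form pairs a projected perturbation, bounded by [kn] or [qn], with a projected
     token split along the dominant row. The two terms in [theta] coincide, whence the factor 2 in
     [M_rope]. *)
  apply: (@cond_head_le +oo%E +oo%E
    (lpnorm +oo%E (col i1 V) * X1 + lpopnorm +oo%E +oo%E V * theta)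
    (kn * (X1 * wq + qn * theta) + (X1 * wk + kn * theta) * qn)).
  - exact: leey.
  - exact: leey.
  - apply: addr_ge0; apply: mulr_ge0 => //; first exact: lpnorm_ge0.
    by apply: lpopnorm_ge0; rewrite ?leey.
  - exact: addr_ge0
      (mulr_ge0 K0 (addr_ge0 (mulr_ge0 X0 wq0) (mulr_ge0 Q0 theta0)))
      (mulr_ge0 (addr_ge0 (mulr_ge0 X0 wk0) (mulr_ge0 K0 theta0)) Q0).
  - by move=> j; rewrite mulrC; apply: lpnorm_dominant_row; exact: leey.
  move=> s t z z' i j z1 z'1.
  apply: lerD; apply: le_trans (rope_dot_le _ _ _ _ rope_grp) _;
    apply: ler_pM; try exact: lpnorm_ge0.
  - exact: unit_le.
  - exact: lpnorm_dominant_row.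
  - exact: lpnorm_dominant_row.
  - exact: unit_le.
have E (c k q x y z t : R) :
    c * (k * (x * y + q * t) + (x * z + k * t) * q) =
    c * (k * y + q * z) * x + 2 * c * q * k * t by ring.
by rewrite E.
Qed.

(** Here the token is split inside the bilinear form: the dominant part is paired with the
    perturbation through Hoelder's inequality between the maximum and l1 norms, the remainder
    through the norm of [Q^T *m K]. *)
Lemma cond_head_dominant_row_norope : (forall t, rope t = 1%:M) ->
  cond_head +oo%E +oo%E WQ WK WV rope h X
    <= lpopnorm +oo%E +oo%E V
       + kappaS * (lpnorm +oo%E (col i1 V) * X1
                   + lpopnorm +oo%E +oo%E V * theta)
         * (mu_norope WQ WK h i1 * X1 + M_norope +oo%E WQ WK h * theta).
Proof.
move=> rope1; rewrite /mu_norope /M_norope.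
have X0 : 0 <= X1 by apply: lpopnorm_ge0; rewrite ?leey.
set B := lpopnorm +oo%E (hoelder_conjugate _) _.
have B0 : 0 <= B.
  by apply: lpopnorm_ge0; [exact: leey|exact/hoelder_conj_ge1/leey].
set wk := lpnorm 1%E (Q^T *m _); set wq := lpnorm 1%E (K^T *m _).
have wk0 : 0 <= wk by exact: lpnorm_ge0.
have wq0 : 0 <= wq by exact: lpnorm_ge0.
have first_le (W : 'M[R]_(dhead, d)) (w : 'cV[R]_dhead) z :
    lpnorm +oo%E z <= 1 -> `|((W *m z)^T *m w) 0 0| <= lpnorm 1%E (W^T *m w).
  move=> z1; rewrite trmx_mul -mulmxA.
  apply: le_trans (hoelder_dot _ _ (leey _)) _.
  by rewrite hoelder_conjugatey; exact: ler_piMl (lpnorm_ge0 _ _) z1.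
have rest_le (x z : 'cV[R]_d) a b :
    lpnorm +oo%E x <= a -> lpnorm +oo%E z <= b ->
    `|((K *m z)^T *m (Q *m x)) 0 0| <= a * (B * b).
  move=> xa zb; apply: le_trans (norope_dot_le x z (leey _)) _; rewrite -/B.
  apply: (ler_pM (lpnorm_ge0 _ _) (mulr_ge0 B0 (lpnorm_ge0 _ _)) xa).
  exact: ler_wpM2l B0 _ _ zb.
have dot_linear (u v w : 'cV[R]_dhead) a :
    (u^T *m (a *: v + w)) 0 0 = a * (u^T *m v) 0 0 + (u^T *m w) 0 0.
  by rewrite mulmxDr -scalemxAr !mxE.
apply: le_trans.
  apply: (@cond_head_le +oo%E +oo%E
    (lpnorm +oo%E (col i1 V) * X1 + lpopnorm +oo%E +oo%E V * theta)
    ((X1 * wq + theta * (B * 1)) + (X1 * wk + 1 * (B * theta)))).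
  - exact: leey.
  - exact: leey.
  - apply: addr_ge0; apply: mulr_ge0 => //; first exact: lpnorm_ge0.
    by apply: lpopnorm_ge0; rewrite ?leey.
  - rewrite mulr1 mul1r; exact: addr_ge0
      (addr_ge0 (mulr_ge0 X0 wq0) (mulr_ge0 theta0 B0))
      (addr_ge0 (mulr_ge0 X0 wk0) (mulr_ge0 B0 theta0)).
  - by move=> j; rewrite mulrC; apply: lpnorm_dominant_row; exact: leey.
  move=> s t z z' i j z1 z'1; rewrite !norope_dotE //.
  have [a [r [aX rt Xi]]] := col_dominant_row i.
  have [b [r' [bX rt' Xj]]] := col_dominant_row j.
  (* The second form is reversed so that in both forms the token being split is the right factor,
     where [dot_linear] applies. *)
  rewrite Xi Xj [X in _ + `|X|]dot_sym !dot_linear.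
  apply: lerD; apply: le_trans (ler_normD _ _) _; apply: lerD.
  - rewrite normrM.
    exact: ler_pM (normr_ge0 _) (normr_ge0 _) _ (first_le _ _ _ _).
  - exact: rest_le.
  - rewrite normrM.
    exact: ler_pM (normr_ge0 _) (normr_ge0 _) _ (first_le _ _ _ _).
  - by rewrite dot_sym; exact: rest_le.
have E (c b x y z t : R) :
    c * (x * y + t * (b * 1) + (x * z + 1 * (b * t))) =
    c * (y + z) * x + 2 * c * b * t by ring.
by rewrite E.
Qed.

End DominantRow.

(** * Comparison of the constants with and without RoPE *)

Lemma M_norope_le p : (1 <= p)%E -> M_norope p WQ WK h <= M_rope p WQ WK h.
Proof.
move=> p1; rewrite /M_norope /M_rope -[leRHS]mulrA; apply: ler_wpM2l.
  by rewrite mulr_ge0 // invr_ge0 sqrtr_ge0.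
exact: lpopnorm_trmx_mul_le.
Qed.

Lemma mu_norope_le i1 : mu_norope WQ WK h i1 <= mu_rope WQ WK h i1.
Proof.
rewrite /mu_norope /mu_rope; apply: ler_wpM2l.
  by rewrite invr_ge0 sqrtr_ge0.
(* The exponent 1 is rewritten as the conjugate of infinity, so that the duality bound through l2
   applies to both summands. *)
by rewrite -hoelder_conjugatey; apply: lerD;
  exact/lpnorm_conjugate_trmx_le/leey.
Qed.

End Head.
End AttentionBounds.

Theorem theorem6p2 (R : realType) (nhead dhead N : nat)
  (nhead_gt0 : (0 < nhead)%N) (dhead_gt0 : (0 < dhead)%N) (N_gt0 : (0 < N)%N)
  (WQ WK WV WO : 'M[R]_(nhead * dhead))
  (rope : int -> 'M[R]_dhead) (rope_grp : rope_group rope)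
  (X : 'M[R]_(nhead * dhead, N)) :
  [/\
   (* part 1 *)
   forall p q : \bar R, (1 <= p)%E -> (1 <= q)%E ->
     cond_attention p q WQ WK WV WO rope X
       <= opnorm (@blocknorm R nhead dhead q) (lpnorm q) WO
          * \big[Num.max/0]_(h < nhead) cond_head p q WQ WK WV rope h X
     /\ forall h : 'I_nhead,
        cond_head p q WQ WK WV rope h X
          <= lpopnorm p q (head_rows WV h)
             * (1 + cond_softmax WQ WK rope h X
                    * M_rope p WQ WK h * lpopnorm 1%E p X ^+ 2),
   (* part 2 *)
   forall (i1 : 'I_(nhead * dhead)) (theta : R),
     nat_of_ord i1 = 0%N ->
     0 <= theta ->
     (forall i, i != i1 -> lpnorm +oo%E (row i X)^T <= theta) ->
     theta < lpnorm +oo%E (row i1 X)^T ->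
     forall h : 'I_nhead,
       cond_head +oo%E +oo%E WQ WK WV rope h X
         <= lpopnorm +oo%E +oo%E (head_rows WV h)
            + cond_softmax WQ WK rope h X
              * (lpnorm +oo%E (col i1 (head_rows WV h)) * lpopnorm 1%E +oo%E X
                 + lpopnorm +oo%E +oo%E (head_rows WV h) * theta)
              * (mu_rope WQ WK h i1 * lpopnorm 1%E +oo%E X
                 + M_rope +oo%E WQ WK h * theta)
   (* part 3 *)
   & (forall t, rope t = 1%:M) ->
     [/\ forall p q : \bar R, (1 <= p)%E -> (1 <= q)%E ->
         forall h : 'I_nhead,
           cond_head p q WQ WK WV rope h X
             <= lpopnorm p q (head_rows WV h)
                * (1 + cond_softmax WQ WK rope h X
                       * M_norope p WQ WK h * lpopnorm 1%E p X ^+ 2),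
         forall (i1 : 'I_(nhead * dhead)) (theta : R),
           nat_of_ord i1 = 0%N ->
           0 <= theta ->
           (forall i, i != i1 -> lpnorm +oo%E (row i X)^T <= theta) ->
           theta < lpnorm +oo%E (row i1 X)^T ->
           forall h : 'I_nhead,
             cond_head +oo%E +oo%E WQ WK WV rope h X
               <= lpopnorm +oo%E +oo%E (head_rows WV h)
                  + cond_softmax WQ WK rope h X
                    * (lpnorm +oo%E (col i1 (head_rows WV h))
                         * lpopnorm 1%E +oo%E X
                       + lpopnorm +oo%E +oo%E (head_rows WV h) * theta)
                    * (mu_norope WQ WK h i1 * lpopnorm 1%E +oo%E X
                       + M_norope +oo%E WQ WK h * theta),
         (* the new constants are no larger *)
         forall p : \bar R, (1 <= p)%E -> forall h : 'I_nhead,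
           M_norope p WQ WK h <= M_rope p WQ WK h
         & forall (i1 : 'I_(nhead * dhead)), nat_of_ord i1 = 0%N ->
           forall h : 'I_nhead, mu_norope WQ WK h i1 <= mu_rope WQ WK h i1]].
Proof.
split.
- move=> p q p1 q1; split; first exact: cond_attention_le.
  by move=> h; exact: cond_head_le_rope.
- move=> i1 theta _ theta0 Xtheta _ h.
  exact: cond_head_dominant_row_rope theta0 Xtheta rope_grp.
move=> rope1; split.
- by move=> p q p1 q1 h; exact: cond_head_le_norope.
- move=> i1 theta _ theta0 Xtheta _ h.
  exact: cond_head_dominant_row_norope theta0 Xtheta rope1.
- by move=> p p1 h; exact: M_norope_le.
- by move=> i1 _ h; exact: mu_norope_le.
Qed.
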